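(* Let $n\ge 3$ and let $M^n$ be an $n$-dimensional complete, connected, smooth Riemannian manifold without boundary, with metric $\langle\,,\rangle$, and suppose $M^n$ is isometric to a Riemannian product $N\times\mathbb{R}$ for some Riemannian manifold $N$. Let $f:M^n\to\mathbb{R}$ be a non-trivial affine function, and let $\alpha:I\subset\mathbb{R}\to M^n$ be a Frenet curve of proper $n$ with Frenet frame $\{V_1,\dots,V_n\}$ and harmonic curvature functions $\{H_1^*,\dots,H_{n-2}^*\}$. If $\alpha$ is an $f$-eikonal $V_n$-slant helix curve with axis $\nabla f$, then along $\alpha$ the axis is given by $$\nabla f=\left\{H_{n-2}^*V_1+\dots+H_1^*V_{n-2}+V_n\right\}\langle\nabla f,V_n\rangle .$$
   Context: A smooth curve $\alpha=\alpha(s):I\to M^n$ ($I\subset\mathbb{R}$ an interval), parametrized by arc length, is a Frenet curve of proper $n$ if there are orthonormal frame fields $\{V_1=\alpha',V_2,\dots,V_n\}$ along $\alpha$ (the Frenet frame) and positive functions $k_1(s),\dots,k_{n-1}(s)$ (the curvatures) with $$\nabla_{\alpha'}V_i=-k_{i-1}V_{i-1}+k_iV_{i+1},\qquad i=1,\dots,n,$$ where $V_0=V_{n+1}=0$ and $\nabla_{\alpha'}$ is the Riemannian (Levi-Civita) connection along $\alpha$. Harmonic curvature functions $H_i^*:I\to\mathbb{R}$ of $\alpha$ (in terms of $V_n$): $$H_0^*=0,\qquad H_1^*=\frac{k_{n-1}}{k_{n-2}},\qquad H_i^*=\frac{1}{k_{n-(i+1)}}\left\{k_{n-i}H_{i-2}^*-(H_{i-1}^*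 )'\right\}\quad(2\le i\le n-2),$$ where $'=d/ds$. $\nabla f$ is the gradient of the (differentiable) function $f$: $df(X)=\langle\nabla f,X\rangle$. A Frenet curve $\alpha$ is an $f$-eikonal $V_n$-slant helix curve, with axis $\nabla f$, if $\|\nabla f\|$ is constant along $\alpha$ and the function $\langle\nabla f,V_n\rangle$ is a non-zero constant along $\alpha$. A function $f:M^n\to\mathbb{R}$ is affine if for every geodesic $\gamma$ of $M^n$ (with affine parameter $t$) the function $t\mapsto f(\gamma(t))$ is of the form $at+b$ with $a,b$ real constants; it is non-trivial if it is not constant. *)

(* Defs.v *)
(* Smooth Riemannian manifolds given by an atlas, on top of MathComp-Analysis. *)
From mathcomp Require Import all_boot all_order all_algebra.
From mathcomp Require Import all_classical all_reals all_analysis.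
Import Order.TTheory GRing.Theory Num.Theory.
Import numFieldNormedType.Exports.

Set Implicit Arguments.
Unset Strict Implicit.
Unset Printing Implicit Defensive.

Local Open Scope classical_set_scope.
Local Open Scope ring_scope.

(* C^oo on the open set U: all iterated partial derivatives are (Frechet)
   differentiable at the points of U; the values of f outside U are irrelevant. *)
Definition smooth_on (R : realType) (n : nat) (W : normedModType R)
    (U : set 'rV[R]_n) (f : 'rV[R]_n -> W) : Prop :=
  forall (s : seq 'I_n) (x : 'rV[R]_n), U x ->
    differentiable
      (foldr (fun a (g : 'rV[R]_n -> W) => 'D_(delta_mx 0 a) g) f s) x.

(* Derivative relative to a subset A of the real line. It is the usual
   derivative at interior points of A and the one-sided derivative at an
   endpoint, so that closed and half-open intervals are covered. *)
Section DerivativeWithin.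
Context (R : realType) (W : normedModType R).
Implicit Types (A : set R) (g : R -> W).

Definition quotient_within A g (s : R) : set_system W :=
  (fun t => (t - s)^-1 *: (g t - g s)) @ within (A `\ s) (nbhs s).

Definition derivable_within A g (s : R) : Prop := cvg (quotient_within A g s).

Definition derive_within A g (s : R) : W := lim (quotient_within A g s).

Definition smooth_within A g : Prop :=
  forall (k : nat) (s : R), A s ->
    derivable_within A (iter k (derive_within A) g) s.

End DerivativeWithin.

Definition nondegenerate_interval (R : realType) (I : set R) : Prop :=
  is_interval I /\ exists a b, [/\ I a, I b & a < b].

(* An atlas of charts [phi i], with inverses [psi i], and the matrices
   [metric i x] of the metric tensor in the coordinates of the chart i.
   [phi i] is only meaningful on [dom i]; [psi i] and [metric i] only on
   [img M i].
   [chart_at p] selects one chart around each p. Throughout, the tangent space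
   at p is identified with 'rV_n through the coordinate basis of [chart_at p];
   the notions below do not depend on that selection, because the coordinate
   changes [tchart] are taken into account. *)
Record riem_data (R : realType) (n : nat) := RiemData {
  carrier :> topologicalType;
  idx : Type;
  dom : idx -> set carrier;
  phi : idx -> carrier -> 'rV[R]_n;
  psi : idx -> 'rV[R]_n -> carrier;
  metric : idx -> 'rV[R]_n -> 'M[R]_n;
  chart_at : carrier -> idx }.

Definition img (R : realType) (n : nat) (M : riem_data R n) (i : idx M) :
    set 'rV[R]_n := phi i @` dom i.

Definition bilin (R : realType) (n : nat) (g : 'M[R]_n) (u v : 'rV[R]_n) : R :=
  (u *m g *m v^T) 0 0.

Record is_riemannian (R : realType) (n : nat) (M : riem_data R n) : Prop := {
  riem_hausdorff : hausdorff_space M;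
  riem_second_countable : @second_countable M;
  riem_chart_at : forall p : M, dom (chart_at p) p;
  riem_open_dom : forall i : idx M, open (dom i);
  riem_open_img : forall i : idx M, open (img i);
  riem_phiK : forall (i : idx M) (p : M), dom i p -> psi i (phi i p) = p;
  riem_phi_continuous : forall i : idx M, {within dom i, continuous (phi i)};
  riem_psi_continuous : forall i : idx M, {within img i, continuous (psi i)};
  riem_transition : forall i j : idx M,
    smooth_on (phi i @` (dom i `&` dom j)) (phi j \o psi i);
  riem_metric_smooth : forall i : idx M, smooth_on (img i) (metric i);
  riem_metric_sym : forall (i : idx M) x, img i x -> (metric i x)^T = metric i x;
  riem_metric_pos : forall (i : idx M) x, img i x ->
    forall u : 'rV[R]_n, u != 0 -> 0 < bilin (metric i x) u u;
  riem_metric_compat : forall (i j : idx M) (p : M), dom i p -> dom j p ->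
    forall u v : 'rV[R]_n,
    bilin (metric i (phi i p)) u v =
    bilin (metric j (phi j p))
          ('d (phi j \o psi i) (phi i p) u) ('d (phi j \o psi i) (phi i p) v) }.

Section Riemannian.
Context (R : realType) (n : nat) (M : riem_data R n).

(* components, in the chart i, of the tangent vector v at p *)
Definition tchart (i : idx M) (p : M) (v : 'rV[R]_n) : 'rV[R]_n :=
  'd (phi i \o psi (chart_at p)) (phi (chart_at p) p) v.

Definition inner (p : M) (u v : 'rV[R]_n) : R :=
  bilin (metric (chart_at p) (phi (chart_at p) p)) u v.

Definition tnorm (p : M) (u : 'rV[R]_n) : R := Num.sqrt (inner p u u).

Definition smooth_fun (f : M -> R) : Prop :=
  forall i : idx M, smooth_on (img i) (f \o psi i).

Definition is_gradient (f : M -> R) (G : M -> 'rV[R]_n) : Prop :=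
  forall (p : M) (v : 'rV[R]_n),
    'd (f \o psi (chart_at p)) (phi (chart_at p) p) v = inner p (G p) v.

Definition christoffel (i : idx M) (x : 'rV[R]_n) (k a b : 'I_n) : R :=
  2^-1 * \sum_(l < n) invmx (metric i x) k l *
    ('D_(delta_mx 0 a) (fun y => metric i y b l) x
     + 'D_(delta_mx 0 b) (fun y => metric i y a l) x
     - 'D_(delta_mx 0 l) (fun y => metric i y a b) x).

Definition smooth_curve (I : set R) (c : R -> M) : Prop :=
  {within I, continuous c} /\
  forall i : idx M, smooth_within (I `&` c @^-1` dom i) (phi i \o c).

Definition velocity (I : set R) (c : R -> M) (s : R) : 'rV[R]_n :=
  derive_within I (phi (chart_at (c s)) \o c) s.

Definition smooth_field_along (I : set R) (c : R -> M) (X : R -> 'rV[R]_n) :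
    Prop :=
  forall i : idx M,
    smooth_within (I `&` c @^-1` dom i) (fun s => tchart i (c s) (X s)).

(* Levi-Civita covariant derivative, along the curve c, of the field X *)
Definition cov_along (I : set R) (c : R -> M) (X : R -> 'rV[R]_n) (s : R) :
    'rV[R]_n :=
  let i := chart_at (c s) in
  derive_within I (fun t => tchart i (c t) (X t)) s
  + \row_(k < n) \sum_(a < n) \sum_(b < n)
      christoffel i (phi i (c s)) k a b * velocity I c s 0 a * X s 0 b.

Definition is_geodesic (I : set R) (c : R -> M) : Prop :=
  smooth_curve I c /\ forall s, I s -> cov_along I c (velocity I c) s = 0.

(* the exponential map is defined on the whole tangent bundle *)
Definition riem_complete : Prop :=
  forall (p : M) (v : 'rV[R]_n), exists c : R -> M,
    [/\ is_geodesic setT c, c 0 = p & velocity setT c 0 = v].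

Definition affine_function (f : M -> R) : Prop :=
  forall (J : set R) (c : R -> M), nondegenerate_interval J ->
    is_geodesic J c -> exists a b : R, forall t, J t -> f (c t) = a * t + b.

Definition nontrivial_function (f : M -> R) : Prop :=
  ~ exists b : R, forall p, f p = b.

(* The frame is V 1, ..., V n and the curvatures are k 1, ..., k n.-1;
   k 0 and k n are unconstrained, since they only multiply V 0 = V n.+1 = 0. *)
Record frenet_curve (I : set R) (c : R -> M) (V : nat -> R -> 'rV[R]_n)
    (k : nat -> R -> R) : Prop := {
  frenet_smooth : smooth_curve I c;
  frenet_frame_smooth : forall i, (1 <= i <= n)%N ->
    smooth_field_along I c (V i);
  frenet_V0 : forall s, I s -> V 0 s = 0;
  frenet_Vn1 : forall s, I s -> V n.+1 s = 0;
  frenet_V1 : forall s, I s -> V 1 s = velocity I c s;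
  frenet_orthonormal : forall i j s,
    (1 <= i <= n)%N -> (1 <= j <= n)%N -> I s ->
    inner (c s) (V i s) (V j s) = (i == j)%:R;
  frenet_curvature_pos : forall i s, (1 <= i <= n.-1)%N -> I s -> 0 < k i s;
  frenet_eq : forall i s, (1 <= i <= n)%N -> I s ->
    cov_along I c (V i) s = - k i.-1 s *: V i.-1 s + k i s *: V i.+1 s }.

(* f-eikonal V_n-slant helix with axis the gradient G of f *)
Definition eikonal_slant_helix (I : set R) (c : R -> M)
    (V : nat -> R -> 'rV[R]_n) (G : M -> 'rV[R]_n) : Prop :=
  (exists r : R, forall s, I s -> tnorm (c s) (G (c s)) = r) /\
  (exists2 r : R, r != 0 & forall s, I s -> inner (c s) (G (c s)) (V n s) = r).

End Riemannian.

Fixpoint harmonic_curvature (R : realType) (n : nat) (I : set R)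
    (k : nat -> R -> R) (i : nat) : R -> R :=
  match i with
  | 0 => fun=> 0
  | i1.+1 =>
    match i1 with
    | 0 => fun s => k n.-1 s / k n.-2 s
    | i2.+1 => fun s =>
        (k (n - i.+1)%N s)^-1 *
        (k (n - i)%N s * harmonic_curvature n I k i2 s
         - derive_within I (harmonic_curvature n I k i1 : R -> R) s)
    end
  end.

Section Maps.
Context (R : realType) (m n : nat) (M : riem_data R m) (N : riem_data R n).

Definition smooth_map (F : M -> N) : Prop :=
  continuous F /\
  forall (i : idx M) (j : idx N),
    smooth_on (phi i @` (dom i `&` F @^-1` dom j)) (phi j \o F \o psi i).

Definition tangent_map (F : M -> N) (p : M) (u : 'rV[R]_m) : 'rV[R]_n :=
  'd (phi (chart_at (F p)) \o F \o psi (chart_at p)) (phi (chart_at p) p) u.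

End Maps.

Section Product.
Context (R : realType) (m n : nat) (M : riem_data R m) (N : riem_data R n).

Definition isometric : Prop :=
  exists (F : M -> N) (G : N -> M),
    [/\ cancel F G, cancel G F, smooth_map F, smooth_map G &
        forall (p : M) (u v : 'rV[R]_m),
          inner (F p) (tangent_map F p u) (tangent_map F p v) = inner p u v].

Definition riem_product : riem_data R (m + n) := {|
  carrier := (M * N)%type;
  idx := (idx M * idx N)%type;
  dom := fun ij => dom ij.1 `*` dom ij.2;
  phi := fun ij p => row_mx (phi ij.1 p.1) (phi ij.2 p.2);
  psi := fun ij x => (psi ij.1 (lsubmx x), psi ij.2 (rsubmx x));
  metric := fun ij x =>
    block_mx (metric ij.1 (lsubmx x)) 0 0 (metric ij.2 (rsubmx x));
  chart_at := fun p => (chart_at p.1, chart_at p.2) |}.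

End Product.

Definition real_line (R : realType) : riem_data R 1 := {|
  carrier := R;
  idx := unit;
  dom := fun=> setT;
  phi := fun _ t => t%:M;
  psi := fun _ x => x 0 0;
  metric := fun _ _ => 1%:M;
  chart_at := fun=> tt |}.

(* Main.v *)
Require Import Defs.
From mathcomp Require Import all_boot all_order all_algebra.
From mathcomp Require Import all_classical all_reals all_analysis.
From mathcomp Require Import ring lra zify.
Import Order.TTheory GRing.Theory Num.Theory.
Import numFieldNormedType.Exports.

(** The gradient of an affine function is a parallel field, so its components in
    a Frenet frame obey the linear system given by the Frenet equations.

    Along a geodesic an affine function has vanishing second derivative, which
    is the covariant Hessian evaluated on the velocity; by completeness every
    tangent vector is the velocity of a geodesic, so the Hessian vanishes on the
    diagonal ([affine_hessian_diag]). It is symmetric, because second partial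
    derivatives commute ([derive2C]) and the Christoffel symbols are symmetric
    in their lower indices, hence it vanishes identically ([affine_hessian]).

    Write h_j = <grad f, V_j> = df(V_j) along the curve. The product rule for df
    along a field ([derivative_dfun_along]) then loses its Hessian term and, by
    the Frenet equations, gives h_j' = - k_(j-1) h_(j-1) + k_j h_(j+1). Since
    h_n is a constant r, the equation for j = n gives h_(n-1) = 0, the one for
    j = n - 1 gives h_(n-2) = r k_(n-1) / k_(n-2), and the others determine
    h_(n-1-i) = r H_i downwards by exactly the recursion defining H
    ([frenet_component_harmonic]). Expanding grad f in the orthonormal frame
    ([orthonormal_expansion]) yields the formula.

    The second derivative of f along a geodesic has to be computed in a fixed
    chart although velocities are given in the chart selected at each point,
    and the curve may live on an interval with endpoints. The chain and product
    rules are therefore established for derivatives relative to a subset of the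
    line, and the changes of chart are absorbed by the chain rule. *)

Set Implicit Arguments.
Unset Strict Implicit.
Unset Printing Implicit Defensive.

Local Open Scope classical_set_scope.
Local Open Scope ring_scope.

(** * One-sided and two-sided derivatives on subsets of the line *)

Section DerivativeWithinTheory.
Context (R : realType).
Implicit Types (A B : set R) (s : R).

(** At a limit point the difference quotient has at most one limit. *)
Lemma within_deleted_proper A s : limit_point A s ->
  ProperFilter (within (A `\ s) (nbhs s)).
Proof.
move=> As; apply: Build_ProperFilter_ex => P; rewrite /within /= => sP.
have [y [ys Ay Py]] := As _ sP.
by exists y; apply: Py; split => //; exact/eqP.
Qed.

Lemma limit_point_interval A s :
  nondegenerate_interval A -> A s -> limit_point A s.
Proof.
move=> [iA [a [b [Aa Ab ab]]]] As.
have [u Au us] : exists2 u, A u & u != s.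
  have [as_|] := eqVneq a s; last by exists a.
  by exists b => //; rewrite -as_ gt_eqF.
move=> U /nbhs_ballP[e /= e0 sU].
(* A small fraction of the way from s to u stays in the interval by
   convexity, and in the ball by the second argument of the minimum. *)
pose t := Num.min 1 (e / (2 * `|u - s|)).
have us0 : 0 < `|u - s| by rewrite normr_gt0 subr_eq0.
have t0 : 0 < t by rewrite /t lt_min ltr01 divr_gt0// mulr_gt0.
have t1 : t <= 1 by rewrite /t ge_min lexx.
exists (s + t * (u - s)); split.
- by rewrite -subr_eq0 addrC addKr mulf_neq0 ?subr_eq0// gt_eqF.
- have [us1|us1] := leP u s.
    apply: (iA u s) => //; apply/andP; split; last first.
      by rewrite gerDl mulr_ge0_le0 ?subr_le0// ltW.
    by rewrite -lerBlDl -[leLHS]mul1r ler_wnM2r// subr_le0//.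
  apply: (iA s u) => //; apply/andP; split.
    by rewrite lerDl mulr_ge0 ?subr_ge0// ltW.
  by rewrite -lerBrDl -[leRHS]mul1r ler_wpM2r// subr_ge0 ltW.
- apply: sU; rewrite -ball_normE /= opprD addNKr normrN normrM gtr0_norm//.
  rewrite -ltr_pdivlMr// (@le_lt_trans _ _ (e / (2 * `|u - s|)))//.
    by rewrite /t ge_min lexx orbT.
  rewrite invfM mulrA ltr_pM2r ?invr_gt0//.
  by rewrite ltr_pdivrMr// ltr_pMr// ltr1n.
Qed.

Lemma within_eventually (T : Type) (F : set_system T) (D P : set T) :
  within D F P = (\forall t \near F, D t -> P t).
Proof. by []. Qed.

Section Vector.
Context (W : normedModType R).
Implicit Types (g h : R -> W) (l : W).

Lemma quotient_within_local A B g s : (\forall t \near s, A t <-> B t) ->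
  quotient_within A g s = quotient_within B g s.
Proof.
move=> AB; rewrite /quotient_within; congr (_ @ _).
apply/seteqP; split=> P; rewrite !within_eventually.
  by move=> H; apply: filterS2 AB H => t [_ BA] AP [/BA At ts]; apply: AP.
by move=> H; apply: filterS2 AB H => t [AB' _] BP [/AB' Bt ts]; apply: BP.
Qed.

Lemma quotient_within_congr A g h s : A s ->
  (\forall t \near s, A t -> g t = h t) ->
  quotient_within A g s = quotient_within A h s.
Proof.
move=> As gh; have ghs := nbhs_singleton gh As.
rewrite /quotient_within; apply/seteqP; split=> P;
  rewrite /nbhs/= !within_eventually => H;
  apply: filterS2 gh H => t gh tP [At ts].
  by have := tP (conj At ts); rewrite /= gh// ghs.
by have := tP (conj At ts); rewrite /= gh// ghs.
Qed.

Lemma derive_within_eq A g s l : limit_point A s ->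
  quotient_within A g s --> l -> derive_within A g s = l.
Proof.
by move=> /within_deleted_proper As gl; exact: cvg_lim.
Qed.

Lemma derivative_within_cvg A g s l : quotient_within A g s --> l ->
  g @ within (A `\ s) (nbhs s) --> g s.
Proof.
move=> gl; rewrite -[g s]addr0 -(scale0r l).
have ts : (t - s) @[t --> within (A `\ s) (nbhs s)] --> (0 : R).
  by rewrite -(subrr s); apply: cvgB; [exact: cvg_within | exact: cvg_cst].
(* g t = g s + (t - s) * (difference quotient), and the quotient converges. *)
apply: cvg_trans (cvgD (cvg_cst (g s)) (cvgZ ts gl)).
apply: near_eq_cvg; rewrite near_withinE.
apply: (@filterE _ (nbhs s)) => t -[At /eqP tns].
by rewrite !fctE /= scalerA mulfV ?subr_eq0// scale1r addrC subrK.
Qed.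

End Vector.

(** The remainder of F at g s is o(|g t - g s|), and |g t - g s| / |t - s|
    stays bounded along the filter, so only the linear part of F survives in
    the difference quotient. *)
Lemma derivative_within_comp (W W' : normedModType R) (F : W -> W') A
    (g : R -> W) s l : quotient_within A g s --> l ->
  differentiable F (g s) -> quotient_within A (F \o g) s --> 'd F (g s) l.
Proof.
move=> gl dF; have gs := derivative_within_cvg gl.
set Q := within _ _ in gs *.
have dQ : 'd F (g s) ((t - s)^-1 *: (g t - g s)) @[t --> Q] --> 'd F (g s) l.
  apply: (cvg_comp _ _ gl); exact: diff_continuous.
rewrite -[X in _ --> X]addr0.
pose rem t := (t - s)^-1 *: (F (g t) - F (g s) - 'd F (g s) (g t - g s)).
have remE : (fun t => (t - s)^-1 *: ((F \o g) t - (F \o g) s)) =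
    (fun t => 'd F (g s) ((t - s)^-1 *: (g t - g s)) + rem t).
  apply/funext => t; rewrite /rem linearZ -scalerDr; congr (_ *: _).
  by rewrite [RHS]addrC subrK.
rewrite /quotient_within remE; apply: cvgD => //.
apply/cvgr0Pnorm_le => e e0.
have k0 : 0 < `|l| + 1 by rewrite ltr_wpDl.
have gl' : (t - s)^-1 *: (g t - g s) @[t --> Q] --> l := gl.
have bound :
    \forall t \near Q, `|(t - s)^-1 *: (g t - g s)| <= `|l| + 1.
  have ll : `|l| < `|l| + 1 by rewrite ltrDl.
  exact: cvgr_norm_le gl' _ ll.
have small : \forall h \near (0 : W),
    `|F (h + g s) - F (g s) - 'd F (g s) h| <= e / (`|l| + 1) * `|h|.
  have /eqaddoP/(_ (e / (`|l| + 1))) := diff_locally dF.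
  rewrite divr_gt0// => /(_ isT); apply: filterS => h.
  by rewrite !fctE /= opprD addrA.
have g0 : g t - g s @[t --> Q] --> (0 : W).
  by rewrite -(subrr (g s)); apply: cvgB => //; exact: cvg_cst.
near=> t; rewrite /rem normrZ.
have b : `|(t - s)^-1 *: (g t - g s)| <= `|l| + 1 by near: t.
have : `|F (g t) - F (g s) - 'd F (g s) (g t - g s)| <=
    e / (`|l| + 1) * `|g t - g s|.
  rewrite -{1}(subrK (g s) (g t)); near: t; exact: g0 small.
move=> /(ler_wpM2l (normr_ge0 (t - s)^-1)) /le_trans; apply.
by rewrite mulrCA -normrZ mulrAC ler_pdivrMr// ler_pM2l.
Unshelve. all: by end_near. Qed.

Lemma derivative_within_coord n A (g : R -> 'rV[R]_n) s (l : 'rV[R]_n) a :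
  quotient_within A g s --> l ->
  quotient_within A (fun t => g t 0 a) s --> l 0 a.
Proof.
move=> gl; rewrite /quotient_within.
have -> : (fun t => (t - s)^-1 *: (g t 0 a - g s 0 a)) =
    (fun N : 'rV[R]_n => N 0 a) \o (fun t => (t - s)^-1 *: (g t - g s)).
  by apply/funext => t; rewrite /= !mxE.
exact: cvg_comp gl (@coord_continuous R 1 n 0 a l).
Qed.

Lemma derivative_withinM A (u v : R -> R) s (du dv : R) :
  quotient_within A u s --> du -> quotient_within A v s --> dv ->
  quotient_within A (fun t => u t * v t) s --> du * v s + u s * dv.
Proof.
move=> udu vdv; have us := derivative_within_cvg udu.
have E : (fun t => (t - s)^-1 *: (u t * v t - u s * v s)) =
    (fun t => (t - s)^-1 *: (u t - u s) * v s
              + u t * ((t - s)^-1 *: (v t - v s))).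
  by apply/funext => t; rewrite /GRing.scale /=; ring.
rewrite /quotient_within E.
apply: cvgD; first by apply: cvgM; [exact: udu | exact: cvg_cst].
by apply: cvgM; [exact: us | exact: vdv].
Qed.

Lemma derivative_within_affine A s (a b : R) :
  quotient_within A (fun t => a * t + b) s --> a.
Proof.
apply: cvg_near_cst; rewrite near_withinE.
apply: (@filterE _ (nbhs s)) => t -[At /eqP ts].
rewrite /GRing.scale /=; field; rewrite subr_eq0; exact: ts.
Qed.

Lemma derivative_withinZ A (u : R -> R) s (a du : R) :
  quotient_within A u s --> du ->
  quotient_within A (fun t => a * u t) s --> a * du.
Proof.
move=> udu; have E : (fun t => (t - s)^-1 *: (a * u t - a * u s)) =
    (fun t => a * ((t - s)^-1 *: (u t - u s))).
  by apply/funext => t; rewrite /GRing.scale /=; ring.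
by rewrite /quotient_within E; apply: cvgM; [exact: cvg_cst | exact: udu].
Qed.

Lemma derivative_within_sum (J : Type) (r : seq J) A (u : J -> R -> R) s
    (du : J -> R) :
  (forall j, quotient_within A (u j) s --> du j) ->
  quotient_within A (fun t => \sum_(j <- r) u j t) s --> \sum_(j <- r) du j.
Proof.
move=> udu; rewrite /quotient_within.
have -> : (fun t => (t - s)^-1 *: (\sum_(j <- r) u j t - \sum_(j <- r) u j s)) =
    (fun t => \sum_(j <- r) (t - s)^-1 *: (u j t - u j s)).
  by apply/funext => t; rewrite -sumrB scaler_sumr.
elim: r => [|j r IH].
  rewrite big_nil; have -> : (fun t => \sum_(j <- [::])
    (t - s)^-1 *: (u j t - u j s)) = cst 0.
    by apply/funext => t; rewrite big_nil.
  exact: cvg_cst.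
rewrite big_cons; have -> : (fun t => \sum_(i <- j :: r)
    (t - s)^-1 *: (u i t - u i s)) = (fun t => (t - s)^-1 *: (u j t - u j s) +
      \sum_(i <- r) (t - s)^-1 *: (u i t - u i s)).
  by apply/funext => t; rewrite big_cons.
by apply: cvgD; [exact: udu | exact: IH].
Qed.

End DerivativeWithinTheory.

(** * Symmetry of second derivatives *)

Section Schwarz.
Context (R : realType) (V : normedModType R).
Implicit Types (F : V -> R) (x u v : V).

Definition second_difference F x u v (h : R) : R :=
  F (x + h *: u + h *: v) - F (x + h *: u) - F (x + h *: v) + F x.

Lemma second_differenceC F x u v : second_difference F x u v =
  second_difference F x v u.
Proof.
by apply/funext => h; rewrite /second_difference (addrAC x); ring.
Qed.

Lemma is_derive_along_line F x u t : differentiable F (x + t *: u) ->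
  is_derive t 1 (fun r => F (x + r *: u)) ('D_u F (x + t *: u)).
Proof.
move=> dF.
pose L (r : R) := x + r *: u.
have dL : is_diff t L ( *:%R^~ u).
  have := is_diffD (is_diff_cst x t) (is_diff_scalel t u).
  by rewrite add0r.
have dFL : is_diff t (F \o L) ('d F (L t) \o ( *:%R^~ u)).
  by apply: is_diff_comp; exact: differentiableP.
have der : derivable (F \o L) t 1 by apply: diff_derivable; exact: ex_diff.
apply: DeriveDef => //.
rewrite deriveE; last exact: ex_diff.
by rewrite (diff_val (is_diff_def := dFL)) /= scale1r deriveE.
Qed.

(** The mean value theorem in the direction u turns the second difference into
    h times an increment of 'D_u F between two points within O(h) of x, and the
    differentiability of 'D_u F at x evaluates that increment up to o(h). *)
Lemma second_difference_cvg F x u v :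
  (\forall y \near x, differentiable F y) ->
  differentiable ('D_u F) x ->
  (h ^+ 2)^-1 * second_difference F x u v h @[h --> 0^'+] -->
    'D_v ('D_u F) x.
Proof.
move=> dF dDF; apply/cvgrPdist_le => e e0.
(* K h bounds the two displacements from x that occur below, and two errors of
   size d K h add up to e h. *)
pose K := 2 * `|u| + `|v| + 1.
have K0 : 0 < K by rewrite /K ltr_wpDl// addr_ge0// mulr_ge0.
pose d := e / (2 * K).
have d0 : 0 < d by rewrite divr_gt0// mulr_gt0.
have small : \forall w \near (0 : V),
    `|'D_u F (w + x) - 'D_u F x - 'd ('D_u F) x w| <= d * `|w|.
  have /eqaddoP/(_ d d0) := diff_locally dDF; apply: filterS => w.
  by rewrite !fctE /= opprD addrA.
have dF0 : \forall w \near (0 : V), differentiable F (w + x).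
  by move: dF; rewrite (near_shift 0) subr0.
have /nbhs_ballP[r /= r0 sr] : nbhs (0 : V) [set w |
    `|'D_u F (w + x) - 'D_u F x - 'd ('D_u F) x w| <= d * `|w| /\
    differentiable F (w + x)].
  by near=> w; split; near: w.
near=> h.
have h0 : 0 < h by [].
have hK : h * K < r.
  rewrite -ltr_pdivlMr//; near: h; apply: nbhs_right_lt; exact: divr_gt0.
have inball a b : 0 <= a <= h -> 0 <= b <= h ->
    ball 0 r (a *: u + b *: v) /\ `|a *: u + b *: v| <= h * K.
  move=> /andP[a0 ah] /andP[b0 bh].
  have le : `|a *: u + b *: v| <= h * K.
    rewrite (le_trans (ler_normD _ _))// !normrZ !ger0_norm//.
    have := ler_wpM2r (normr_ge0 u) ah; have := ler_wpM2r (normr_ge0 v) bh.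
    have := mulr_ge0 (ltW h0) (normr_ge0 u).
    by rewrite /K; nra.
  split=> //; rewrite -ball_normE /= sub0r normrN; exact: le_lt_trans hK.
pose phi (t : R) := F (x + h *: v + t *: u) - F (x + t *: u).
pose dphi (t : R) := 'D_u F (x + h *: v + t *: u) - 'D_u F (x + t *: u).
have hh : 0 <= h <= h by rewrite lexx ltW.
have oo : 0 <= (0 : R) <= h by rewrite lexx ltW.
have dphiP t : 0 <= t <= h -> is_derive t 1 phi (dphi t).
  move=> th; apply: is_deriveB; apply: is_derive_along_line.
    have [/sr[_ +] _] := inball t h th hh.
    by rewrite addrC [t *: u + _]addrC addrA.
  have [/sr[_ +] _] := inball t 0 th oo.
  by rewrite scale0r addr0 addrC.
have [t] : exists2 t, t \in `]0, h[%R & phi h - phi 0 = dphi t * (h - 0).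
  apply: MVT => //.
    by move=> t /itvP th; apply: dphiP; rewrite !th.
  apply: derivable_within_continuous => t /itvP th.
  by have [] := dphiP t; rewrite ?th.
rewrite in_itv /= => /andP[t0 th].
rewrite subr0 => E.
have sE : second_difference F x u v h = dphi t * h.
  rewrite -E /phi /second_difference scale0r !addr0 (addrAC x); ring.
rewrite sE deriveE//.
have tt : 0 <= t <= h by rewrite !ltW.
have [/sr[A1 _] N1] := inball t h tt hh.
have [/sr[A2 _] N2] := inball t 0 tt oo.
have {}A1 := le_trans A1 (ler_wpM2l (ltW d0) N1).
have {}A2 := le_trans A2 (ler_wpM2l (ltW d0) N2).
rewrite scale0r addr0 in A2.
have incr : `|h * 'd ('D_u F) x v - dphi t| <= e * h.
  have -> : e * h = d * (h * K) + d * (h * K).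
    by rewrite /d; field; rewrite gt_eqF.
  have := lerD A1 A2; apply: le_trans.
  rewrite -[X in _ <= X + _]normrN (le_trans _ (ler_normD _ _))//.
  have -> : dphi t =
      'D_u F (t *: u + h *: v + x) - 'D_u F (t *: u + x).
    by rewrite /dphi (addrC x (t *: u)) -(addrA x) (addrC x) (addrC (h *: v)).
  rewrite le_eqVlt; apply/orP; left; apply/eqP; congr (`|_|).
  have -> : 'd ('D_u F) x (t *: u + h *: v) =
      'd ('D_u F) x (t *: u) + h * 'd ('D_u F) x v.
    by rewrite linearD; congr (_ + _); exact: linearZ.
  ring.
have -> : 'd ('D_u F) x v - (h ^+ 2)^-1 * (dphi t * h) =
    (h * 'd ('D_u F) x v - dphi t) / h by field; rewrite gt_eqF.
by rewrite normrM normfV (gtr0_norm h0) ler_pdivrMr.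
Unshelve. all: by end_near. Qed.

(** Schwarz: the second difference is symmetric in u and v, so the limits it has
    for the two orders of differentiation coincide. *)
Lemma derive2C F x u v :
  (\forall y \near x, differentiable F y) ->
  differentiable ('D_u F) x -> differentiable ('D_v F) x ->
  'D_v ('D_u F) x = 'D_u ('D_v F) x.
Proof.
move=> dF du dv; have uv := second_difference_cvg (v := v) dF du.
have := second_difference_cvg (v := u) dF dv.
rewrite second_differenceC => vu; exact: cvg_unique uv vu.
Qed.

End Schwarz.

(** * Charts and covariant derivatives along curves *)

Section Charts.
Context (R : realType) (n : nat) (M : riem_data R n) (hM : is_riemannian M).
Implicit Types (i j : idx M) (p : M) (f : M -> R) (I : set R) (c : R -> M).

Lemma img_phi i p : dom i p -> img i (phi i p).
Proof. by move=> ip; exists p. Qed.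

Lemma phi_psiK i x : img i x -> phi i (psi i x) = x.
Proof. by move=> [p ip <-]; rewrite (riem_phiK hM). Qed.

Lemma near_img i p : dom i p -> \forall y \near phi i p, img i y.
Proof.
move=> ip; apply: open_nbhs_nbhs; split; first exact: (riem_open_img hM).
exact: img_phi.
Qed.

Lemma near_dom i p : dom i p -> nbhs p (dom i).
Proof.
by move=> ip; apply: open_nbhs_nbhs; split=> //; exact: (riem_open_dom hM).
Qed.

Lemma near_psi i p (U : set M) : dom i p -> nbhs p U ->
  \forall y \near phi i p, U (psi i y).
Proof.
move=> ip pU.
have /subspace_continuousP/(_ _ (img_phi ip)) :=
  riem_psi_continuous hM (i := i).
move=> cts; have psiU : nbhs (psi i (phi i p)) U by rewrite (riem_phiK hM).
have H : \forall y \near phi i p, img i y -> U (psi i y) := cts _ psiU.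
by apply: filterS2 (near_img ip) H => y yi; exact.
Qed.

Lemma transition_differentiable i j p : dom i p -> dom j p ->
  differentiable (phi j \o psi i) (phi i p).
Proof.
move=> ip jp; have H : (phi i @` (dom i `&` dom j)) (phi i p) by exists p.
exact: (@riem_transition _ _ _ hM i j [::] (phi i p) H).
Qed.

Lemma smooth_fun_differentiable f i p : smooth_fun f -> dom i p ->
  differentiable (f \o psi i) (phi i p).
Proof. by move=> fs ip; apply: (fs i [::]); exact: img_phi. Qed.

Lemma near_eq_diff (V W : normedModType R) (g h : V -> W) x v :
  differentiable g x -> differentiable h x ->
  (\forall y \near x, g y = h y) -> 'd g x v = 'd h x v.
Proof. by move=> dg dh gh; rewrite -!deriveE//; exact: near_eq_derive. Qed.

(** The base point of the outer differential is a separate variable y because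
    points of a chart are known only up to a propositional equality, along which
    the type of a differential cannot be rewritten. *)
Lemma diff_compE (V1 V2 V3 : normedModType R) (g : V1 -> V2) (h : V2 -> V3)
    x y v :
  g x = y -> differentiable g x -> differentiable h y ->
  'd (h \o g) x v = 'd h y ('d g x v).
Proof. by move=> <- dg dh; rewrite diff_comp. Qed.

(** The differential of f is intrinsic: only the components of the vector change
    with the chart. *)
Lemma diff_chart_change f i j p v : smooth_fun f -> dom i p -> dom j p ->
  'd (f \o psi i) (phi i p) v =
  'd (f \o psi j) (phi j p) ('d (phi j \o psi i) (phi i p) v).
Proof.
move=> fs ip jp.
have dt := transition_differentiable ip jp.
have E : (phi j \o psi i) (phi i p) = phi j p by rewrite /= (riem_phiK hM).
have df := smooth_fun_differentiable fs jp.
have dfi := smooth_fun_differentiable fs ip.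
have dc : differentiable ((f \o psi j) \o (phi j \o psi i)) (phi i p).
  by apply: differentiable_comp; [exact: dt | rewrite E; exact: df].
apply: etrans (diff_compE _ E dt df); apply: (near_eq_diff _ dfi dc).
apply: filterS (near_psi ip (near_dom jp)) => y jy.
by rewrite /= (riem_phiK hM).
Qed.

Lemma tchart_self p v : tchart (chart_at p) p v = v.
Proof.
have cp := riem_chart_at hM p.
rewrite /tchart (@near_eq_diff _ _ _ id) ?diff_val//.
  exact: transition_differentiable.
by apply: filterS (near_img cp) => y; exact: phi_psiK.
Qed.

Section Curves.
Context (I : set R) (c : R -> M) (cc : {within I, continuous c}).

Lemma near_curve s (U : set M) : I s -> nbhs (c s) U ->
  \forall t \near s, I t -> U (c t).
Proof. by move=> Is; have /subspace_continuousP/(_ _ Is) := cc; exact. Qed.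

(** Regularity of curves and fields is stated on the part of I that lies in a
    chart domain; near a given parameter that part is all of I. *)
Lemma quotient_within_chart (W : normedModType R) i (g : R -> W) s :
  I s -> dom i (c s) ->
  quotient_within (I `&` c @^-1` dom i) g s = quotient_within I g s.
Proof.
move=> Is is_; apply: quotient_within_local.
apply: filterS (near_curve Is (near_dom is_)) => t H.
by split=> [[]//|It]; split=> //; exact: H.
Qed.

Lemma derivative_chart_change i j s l : I s -> dom i (c s) -> dom j (c s) ->
  quotient_within I (phi i \o c) s --> l ->
  quotient_within I (phi j \o c) s --> 'd (phi j \o psi i) (phi i (c s)) l.
Proof.
move=> Is si sj cl.
rewrite (@quotient_within_congr _ _ I _ ((phi j \o psi i) \o (phi i \o c)))//.
  by apply: derivative_within_comp => //; exact: transition_differentiable.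
apply: filterS (near_curve Is (near_dom si)) => t H It /=.
by rewrite (riem_phiK hM)//; exact: H.
Qed.

End Curves.

Lemma derivative_curve I c i s : smooth_curve I c -> I s -> dom i (c s) ->
  quotient_within I (phi i \o c) s --> tchart i (c s) (velocity I c s).
Proof.
move=> [cc cs] Is si.
have sc := riem_chart_at hM (c s).
apply: derivative_chart_change => //.
have := cs (chart_at (c s)) 0 s (conj Is sc).
by rewrite /derivable_within quotient_within_chart//.
Qed.

(** In a fixed chart the velocity is the first derivative of the coordinates at
    every nearby parameter, hence differentiable once more. *)
Lemma derivable_velocity I c i s : nondegenerate_interval I ->
  smooth_curve I c -> I s -> dom i (c s) ->
  derivable_within I (fun t => tchart i (c t) (velocity I c t)) s.
Proof.
move=> nI sc Is si; have [cc cs] := sc.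
have := cs i 1 s (conj Is si).
rewrite /derivable_within quotient_within_chart//=.
rewrite (@quotient_within_congr _ _ I _
  (fun t => tchart i (c t) (velocity I c t)))//.
apply: filterS (near_curve cc Is (near_dom si)) => t H It; have ti := H It.
rewrite /derive_within quotient_within_chart//.
apply: derive_within_eq; last exact: derivative_curve.
exact: limit_point_interval.
Qed.

Definition dfun f p (v : 'rV[R]_n) : R :=
  'd (f \o psi (chart_at p)) (phi (chart_at p) p) v.

Lemma dfunD f p u v : dfun f p (u + v) = dfun f p u + dfun f p v.
Proof. exact: linearD. Qed.

Lemma dfunZ f p a v : dfun f p (a *: v) = a * dfun f p v.
Proof. exact: linearZ. Qed.

Lemma dfun0 f p : dfun f p 0 = 0.
Proof. exact: linear0. Qed.

(** The components of the covariant Hessian of f in the chart i. *)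
Definition hessian_coef f i (x : 'rV[R]_n) (a b : 'I_n) : R :=
  'D_(delta_mx 0 a) ('D_(delta_mx 0 b) (f \o psi i)) x
  - \sum_(k < n) christoffel i x k a b * 'D_(delta_mx 0 k) (f \o psi i) x.

Definition hessian f p (u v : 'rV[R]_n) : R :=
  \sum_(a < n) \sum_(b < n) u 0 a * v 0 b *
    hessian_coef f (chart_at p) (phi (chart_at p) p) a b.

Lemma diff_partial (F : 'rV[R]_n -> R) x v : differentiable F x ->
  'd F x v = \sum_(a < n) v 0 a * 'D_(delta_mx 0 a) F x.
Proof.
move=> dF; rewrite {1}(row_sum_delta v) linear_sum; apply: eq_bigr => a _.
by rewrite linearZ deriveE.
Qed.

(** With G the Christoffel symbols and P the partial derivatives of f, the
    Christoffel terms of df(DX) and of the Hessian cancel, which leaves ordinary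
    second partial derivatives. *)
Lemma christoffel_cancel (G : 'I_n -> 'I_n -> 'I_n -> R) (D : 'I_n -> 'I_n -> R)
    (P u v : 'I_n -> R) :
  \sum_k (\sum_a \sum_b G k a b * u a * v b) * P k
  + \sum_a \sum_b u a * v b * (D a b - \sum_k G k a b * P k)
  = \sum_b v b * \sum_a u a * D a b.
Proof.
have -> : \sum_k (\sum_a \sum_b G k a b * u a * v b) * P k =
    \sum_a \sum_b u a * v b * \sum_k G k a b * P k.
  under eq_bigr do rewrite mulr_suml.
  rewrite exchange_big; apply: eq_bigr => a _ /=.
  under eq_bigr do rewrite mulr_suml.
  rewrite exchange_big; apply: eq_bigr => b _ /=.
  by rewrite mulr_sumr; apply: eq_bigr => k _; ring.
under [RHS]eq_bigr do rewrite mulr_sumr.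
rewrite [RHS]exchange_big -big_split; apply: eq_bigr => a _ /=.
by rewrite -big_split; apply: eq_bigr => b _ /=; ring.
Qed.

(** The Leibniz rule (df(X))' = df(DX) + Hess f (c', X): near s everything is
    read in the single chart at c s, where df(X) is a sum of products of
    components of X by partial derivatives of f. *)
Lemma derivative_dfun_along f I c X s :
  smooth_fun f -> smooth_curve I c -> I s ->
  derivable_within I (fun t => tchart (chart_at (c s)) (c t) (X t)) s ->
  quotient_within I (fun t => dfun f (c t) (X t)) s -->
    dfun f (c s) (cov_along I c X s) + hessian f (c s) (velocity I c s) (X s).
Proof.
move=> fs sc Is dX; have [cc cs] := sc.
set i := chart_at (c s) in dX *.
have si : dom i (c s) := riem_chart_at hM (c s).
pose F := f \o psi i; pose x := phi i (c s).
pose Y t := tchart i (c t) (X t).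
have ix : img i x by exact: img_phi.
have Ys : Y s = X s by exact: tchart_self.
rewrite (@quotient_within_congr _ _ I _
  (fun t => \sum_(b < n)
     Y t 0 b * ('D_(delta_mx 0 b) F \o (phi i \o c)) t))//; last first.
  apply: filterS (near_curve cc Is (near_dom si)) => t H It; have ti := H It.
  rewrite -diff_partial; last exact: smooth_fun_differentiable.
  by rewrite /Y /tchart -diff_chart_change//; exact: (riem_chart_at hM).
have dc := derivative_curve sc Is si; rewrite tchart_self in dc.
set w := velocity I c s in dc *.
have -> : dfun f (c s) (cov_along I c X s) + hessian f (c s) w (X s) =
    \sum_(b < n)
      (derive_within I Y s 0 b * ('D_(delta_mx 0 b) F \o (phi i \o c)) s
      + Y s 0 b * 'd ('D_(delta_mx 0 b) F) x w).
  rewrite big_split /= /dfun diff_partial; last first.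
    exact: smooth_fun_differentiable.
  rewrite Ys /cov_along -/i -/x -/F -/Y -/w.
  have -> : \sum_(b < n) X s 0 b * 'd ('D_(delta_mx 0 b) F) x w =
      \sum_(b < n) X s 0 b *
        \sum_(a < n) w 0 a * 'D_(delta_mx 0 a) ('D_(delta_mx 0 b) F) x.
    apply: eq_bigr => b _; congr (_ * _).
    by apply: diff_partial; exact: (fs i [:: b] x ix).
  rewrite -(christoffel_cancel (christoffel i x) _
    (fun k => 'D_(delta_mx 0 k) F x)) [RHS]addrA; congr (_ + _).
  rewrite -big_split /=.
  by apply: eq_bigr => a _; rewrite !mxE mulrDl.
apply: derivative_within_sum => b.
apply: derivative_withinM; first exact: derivative_within_coord dX.
by apply: derivative_within_comp => //; exact: (fs i [:: b] x ix).
Qed.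

(** The Levi-Civita connection is torsion-free. *)
Lemma christoffelC i x k a b : img i x ->
  christoffel i x k a b = christoffel i x k b a.
Proof.
move=> ix; rewrite /christoffel; congr (_ * _); apply: eq_bigr => l _.
congr (_ * _); rewrite [in RHS](addrC ('D_(delta_mx 0 b) _ x)); congr (_ - _).
apply: near_eq_derive.
have [p ip px] := ix; rewrite -px.
apply: filterS (near_img ip) => y iy.
by rewrite -{1}(riem_metric_sym hM iy) mxE.
Qed.

Lemma hessian_coefC f i x a b : smooth_fun f -> img i x ->
  hessian_coef f i x a b = hessian_coef f i x b a.
Proof.
move=> fs ix; rewrite /hessian_coef.
under eq_bigr do rewrite christoffelC//.
have dF : \forall y \near x, differentiable (f \o psi i) y.
  have [p ip px] := ix; rewrite -px.
  by apply: filterS (near_img ip) => y; exact: (fs i [::]).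
have dDF a' : differentiable ('D_(delta_mx 0 a') (f \o psi i)) x.
  exact: (fs i [:: a'] x ix).
by rewrite (derive2C dF (dDF b) (dDF a)).
Qed.

Lemma hessianC f p u v : smooth_fun f -> hessian f p u v = hessian f p v u.
Proof.
move=> fs; rewrite /hessian exchange_big /=; apply: eq_bigr => a _.
apply: eq_bigr => b _; rewrite hessian_coefC//.
  by rewrite (mulrC (u 0 b)).
exact: img_phi (riem_chart_at hM p).
Qed.

Lemma hessianDl f p u v w :
  hessian f p (u + v) w = hessian f p u w + hessian f p v w.
Proof.
rewrite /hessian /= -big_split; apply: eq_bigr => a _ /=.
by rewrite -big_split; apply: eq_bigr => b _ /=; rewrite mxE !mulrDl.
Qed.

(** Along the geodesic with initial velocity v, the Leibniz rule for the
    velocity field equates the Hessian with the derivative of (f o c)', which is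
    constant. *)
Lemma affine_hessian_diag f p v : riem_complete M -> smooth_fun f ->
  affine_function f -> hessian f p v v = 0.
Proof.
move=> cM fs fa; have [c [[sc geo] c0 cv]] := cM p v.
have nT : nondegenerate_interval [set: R].
  by split=> //; exists 0, 1; split=> //; exact: ltr01.
have [a [b fab]] := fa _ _ nT (conj sc geo).
have lT s : limit_point [set: R] s by exact: limit_point_interval.
have vel s : dfun f (c s) (velocity setT c s) = a.
  have sd := riem_chart_at hM (c s).
  have := derivative_curve sc (s := s) Logic.I sd.
  rewrite tchart_self => /derivative_within_comp.
  move=> /(_ _ _ (smooth_fun_differentiable fs sd)).
  rewrite (@quotient_within_congr _ _ _ _ (fun t => a * t + b))//.
    move=> /(derive_within_eq (lT s)) H; apply: etrans (esym H) _.
    by apply: derive_within_eq; [exact: lT | exact: derivative_within_affine].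
  apply: filterS (near_curve sc.1 (s := s) Logic.I (near_dom sd)) => t H It.
  by rewrite /= (riem_phiK hM) ?fab//; exact: H.
have sd := riem_chart_at hM (c 0).
have dv := derivable_velocity nT sc (s := 0) Logic.I sd.
have := derivative_dfun_along fs sc (s := 0) Logic.I dv.
rewrite (_ : (fun t => _) = fun t => 0 * t + a); last first.
  by apply/funext => t; rewrite mul0r add0r; exact: vel.
move=> /(derive_within_eq (lT 0)).
rewrite geo// dfun0 add0r c0 cv => <-.
by apply: derive_within_eq; [exact: lT | exact: derivative_within_affine].
Qed.

(** Polarization of [affine_hessian_diag], the Hessian being symmetric. *)
Lemma affine_hessian f p u v : riem_complete M -> smooth_fun f ->
  affine_function f -> hessian f p u v = 0.
Proof.
move=> cM fs fa; have := affine_hessian_diag p (u + v) cM fs fa.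
rewrite hessianDl hessianC// hessianDl [X in _ + X]hessianC// hessianDl.
rewrite !affine_hessian_diag// add0r addr0 (hessianC p v u fs).
by move/eqP; rewrite -mulr2n mulrn_eq0 /= => /eqP.
Qed.

End Charts.

(** * Frames and harmonic curvatures *)

(** If the rows of A are the frame and g is the metric, orthonormality says
    that A (g A^T) = 1; the square matrices commute, so w = (w g A^T) A, and
    w g A^T is the row of the inner products. *)
Lemma orthonormal_expansion (R : realType) (n : nat) (M : riem_data R n) (p : M)
    (e : nat -> 'rV[R]_n) (w : 'rV[R]_n) :
  (forall i j, (1 <= i <= n)%N -> (1 <= j <= n)%N ->
    inner p (e i) (e j) = (i == j)%:R) ->
  w = \sum_(1 <= j < n.+1) inner p w (e j) *: e j.
Proof.
move=> orth; set g := metric (chart_at p) (phi (chart_at p) p).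
pose A := \matrix_(i < n) e i.+1.
have entry u (i : 'I_n) : (u *m g *m A^T) 0 i = inner p u (e i.+1).
  rewrite /inner /bilin -/g !mxE; apply: eq_bigr => j _.
  by rewrite !mxE.
have AgA : A *m (g *m A^T) = 1%:M.
  rewrite mulmxA; apply/matrixP => i j; rewrite [RHS]mxE.
  have -> : (A *m g *m A^T) i j = (row i A *m g *m A^T) 0 j.
    by rewrite -!row_mul [RHS]mxE.
  by rewrite entry rowK orth// ?ltn_ord// eqSS.
rewrite -[LHS]mulmx1 -(mulmx1C AgA) !mulmxA mulmx_sum_row.
rewrite big_add1 big_mkord; apply: eq_bigr => i _.
by rewrite entry rowK.
Qed.

(** Reading the Frenet equations from the last one upwards determines each
    component from the two above it, by the recursion that defines the
    harmonic curvatures. *)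
Lemma frenet_component_harmonic (R : realType) (n : nat) (I : set R)
    (k h : nat -> R -> R) (r : R) : (3 <= n)%N -> nondegenerate_interval I ->
  r != 0 ->
  (forall i s, (1 <= i <= n.-1)%N -> I s -> 0 < k i s) ->
  (forall j s, (1 <= j <= n)%N -> I s -> quotient_within I (h j) s -->
     - k j.-1 s * h j.-1 s + k j s * h j.+1 s) ->
  (forall s, I s -> h n s = r) -> (forall s, I s -> h n.+1 s = 0) ->
  forall i s, (i <= n.-2)%N -> I s ->
    h (n.-1 - i)%N s = r * harmonic_curvature n I k i s.
Proof.
case: n => [|[|[|n]]]// _ nI r0 k0 dh hn hn1.
have recursion j (u : R -> R) s (d : R) : (1 <= j <= n.+3)%N -> I s ->
    (forall t, I t -> h j t = u t) -> quotient_within I u s --> d ->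
    d = - k j.-1 s * h j.-1 s + k j s * h j.+1 s.
  move=> jn Is hu ud; have lp := limit_point_interval nI Is.
  rewrite -(derive_within_eq lp (dh j s jn Is)).
  apply/esym/derive_within_eq => //.
  by rewrite (@quotient_within_congr _ _ I _ u)//; exact: filterE hu.
have cst_cvg (a s : R) : quotient_within I (fun=> a) s --> (0 : R).
  have -> : (fun=> a) = (fun t => 0 * t + a).
    by apply/funext => t; rewrite mul0r add0r.
  exact: derivative_within_affine.
have P0 s : I s -> h n.+2 s = 0.
  move=> Is; have := recursion n.+3 _ s 0 _ Is hn (cst_cvg r s).
  rewrite leqnn hn1// mulr0 addr0 => /(_ isT)/eqP.
  rewrite /= eq_sym mulf_eq0 oppr_eq0 (gt_eqF (k0 _ _ _ Is))//=.
  by move/eqP.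
have P1 s : I s -> h n.+1 s = r * (k n.+2 s / k n.+1 s).
  move=> Is; have := recursion n.+2 _ s 0 _ Is P0 (cst_cvg 0 s).
  rewrite hn//= leqnSn => /(_ isT) E.
  have kp : k n.+1 s != 0 by rewrite gt_eqF// k0//= leqnSn.
  have : k n.+1 s * h n.+1 s = k n.+2 s * r by lra.
  by move=> /(canRL (mulKf kp)) ->; field.
suff pair i : (i <= n)%N -> forall s, I s ->
    h (n.+2 - i)%N s = r * harmonic_curvature n.+3 I k i s /\
    h (n.+2 - i.+1)%N s = r * harmonic_curvature n.+3 I k i.+1 s.
  case=> [|i] s /= i_n Is; first by rewrite P0// mulr0.
  by have [] := pair i i_n s Is.
elim: i => [|i IH] i_n s Is.
  by rewrite P0// mulr0; split=> //; exact: P1.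
have [Hi Hi1] := IH (ltnW i_n) s Is; split=> //.
pose H := harmonic_curvature n.+3 I k.
set j := (n.+2 - i.+1)%N in Hi1 *.
have jn : (1 <= j <= n.+3)%N by rewrite /j; lia.
have jp : (n.+2 - i.+2)%N = j.-1 by rewrite /j; lia.
have js : (n.+2 - i)%N = j.+1 by rewrite /j; lia.
(* H i.+1 is differentiable because it coincides with h j / r on I. *)
have dHj := derivative_withinZ (a := r^-1) (dh j s jn Is).
rewrite (@quotient_within_congr _ _ I _ (H i.+1)) in dHj => //; last first.
  apply: filterE => t It; have [_ ->] := IH (ltnW i_n) t It.
  by rewrite mulKf.
have dH := derive_within_eq (limit_point_interval nI Is) dHj.
have jE : (n.+3 - i.+2)%N = j by rewrite /j; lia.
have j1E : (n.+3 - i.+3)%N = j.-1 by rewrite /j; lia.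
rewrite jp [RHS]/=.
have HE : harmonic_curvature n.+3 I k i.+2 s = (k (n.+3 - i.+3)%N s)^-1 *
  (k (n.+3 - i.+2)%N s * H i s - derive_within I (H i.+1) s) by [].
rewrite -[RHS]/(r * harmonic_curvature n.+3 I k i.+2 s) HE jE j1E dH.
rewrite js in Hi.
have kp : k j.-1 s != 0 by rewrite gt_eqF// k0// /j; lia.
rewrite Hi /H; field; exact/andP.
Qed.

Lemma sum_last_two (W : zmodType) (n : nat) (G : nat -> W) : (2 <= n)%N ->
  \sum_(1 <= j < n.+1) G j = \sum_(1 <= j < n.-1) G j + G n.-1 + G n.
Proof.
case: n => [|[|n]]// _; rewrite big_nat_recr//=; congr (_ + _).
by rewrite big_nat_recr.
Qed.

Theorem theorem4p2 (R : realType) (n : nat) (hn : (3 <= n)%N)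
    (M : riem_data R n) (hM : is_riemannian M)
    (hcomplete : riem_complete M) (hconnected : connected [set: M])
    (hproduct : exists (m : nat) (N : riem_data R m),
       is_riemannian N /\ isometric M (riem_product N (real_line R)))
    (f : M -> R) (hsmooth : smooth_fun f) (haffine : affine_function f)
    (hnontrivial : nontrivial_function f)
    (grad_f : M -> 'rV[R]_n) (hgrad : is_gradient f grad_f)
    (I : set R) (hI : nondegenerate_interval I) (alpha : R -> M)
    (V : nat -> R -> 'rV[R]_n) (k : nat -> R -> R)
    (hfrenet : frenet_curve I alpha V k)
    (hhelix : eikonal_slant_helix I alpha V grad_f) :
  let H := harmonic_curvature n I k in
  forall s : R, I s ->
    grad_f (alpha s) =
    inner (alpha s) (grad_f (alpha s)) (V n s) *:
      (\sum_(1 <= j < n.-1) H (n.-1 - j)%N s *: V j s + V n s).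
Proof.
move=> H s Is; have [_ [r r0 hr]] := hhelix.
have [sc fsm V0 Vn1 _ orth kpos feq] := hfrenet.
pose h j t := dfun f (alpha t) (V j t).
have hE j t : h j t = inner (alpha t) (grad_f (alpha t)) (V j t).
  exact: hgrad.
have dh j t : (1 <= j <= n)%N -> I t -> quotient_within I (h j) t -->
    - k j.-1 t * h j.-1 t + k j t * h j.+1 t.
  move=> jn It; have td := riem_chart_at hM (alpha t).
  have dV := fsm j jn (chart_at (alpha t)) 0 t (conj It td).
  rewrite /derivable_within (quotient_within_chart hM sc.1 _ It td) in dV.
  have := derivative_dfun_along hM hsmooth sc It dV.
  rewrite affine_hessian// addr0 feq//.
  by rewrite dfunD !dfunZ.
have key := frenet_component_harmonic hn hI r0 kpos dh.
have {}key i t : (i <= n.-2)%N -> I t -> h (n.-1 - i)%N t = r * H i t.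
  apply: key => u Iu; first by rewrite hE hr.
  by rewrite /h Vn1// dfun0.
rewrite hr// {1}(orthonormal_expansion (grad_f (alpha s))
  (fun i j i1 j1 => orth i j s i1 j1 Is)).
have hn1 : h n.-1 s = 0 by have := key 0 s isT Is; rewrite subn0 mulr0.
rewrite sum_last_two ?(ltnW hn)// hr// -hE hn1 scale0r addr0 scalerDr.
congr (_ + _); rewrite scaler_sumr !big_nat; apply: eq_bigr => j jn.
rewrite scalerA -key//; last by lia.
by rewrite subKn ?hE//; lia.
Qed.
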